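(* Let $\lambda$ and $\beta$ be positive random variables on a probability space $(\Omega,\mathcal F,\mathbb P)$ satisfying $$\mathbb E\left[\frac{\beta}{\lambda^{1/\beta}}\left(\frac{\beta+1}{\beta}\right)^{\frac{\beta+1}{\beta}}\right]<\infty,\qquad \mathbb E[\lambda]<\infty,\qquad \mathbb E[\lambda\beta]<\infty ,$$ and consider the Kies mixture with CDF $F(t)=\mathbb E[H(t;\lambda,\beta)]$. Define, for $x\in[0,\infty)$, $$\gamma(x)=x\left[\frac{1}{\mathbb E\left[e^{-\lambda x^\beta}\right]}-1\right].$$ Then the equation $\gamma(x)=1$ has a unique root $\overline x$ in $[0,\infty)$, and, with $\tau=\lambda\,\overline x^{\,\beta}$, the saturation $d$ of the Kies mixture is $$d=\mathbb E\left[e^{-\tau}\right]=\frac{\overline x}{\overline x+1}.$$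
   Context: For constants $\lambda,\beta>0$ the Kies CDF is $H(t;\lambda,\beta)=1-\exp\left(-\lambda\left(\frac{t}{1-t}\right)^\beta\right)$ for $t\in[0,1)$, with $H(1;\lambda,\beta)=1$; for random $\lambda,\beta$ it is evaluated pointwise in $\omega$. Equip $\mathbb R^2$ with the max-norm $\lVert(t_A,x_A)-(t_B,x_B)\rVert=\max\{|t_A-t_B|,|x_A-x_B|\}$. The Hausdorff distance between two curves $g,h\subset\mathbb R^2$ is $\max\left\{\sup_{A\in g}\inf_{B\in h}\lVert A-B\rVert,\ \sup_{B\in h}\inf_{A\in g}\lVert A-B\rVert\right\}$. The saturation of a distribution on $(0,1)$ with CDF $F$ is the Hausdorff distance between the completed graph of $F$ on $[0,1]$ (for continuous $F$, simply $\{(t,F(t)):t\in[0,1]\}$) and the curve consisting of the vertical segment from $(0,0)$ to $(0,1)$ and the horizontal segment from $(0,1)$ to $(1,1)$. *)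

(* Defs.v *)
From HB Require Import structures.
From mathcomp Require Import all_boot all_order all_algebra.
From mathcomp Require Import all_classical all_reals all_analysis.
Set Implicit Arguments.
Unset Strict Implicit.
Unset Printing Implicit Defensive.
Import Order.TTheory GRing.Theory Num.Theory.
Import numFieldNormedType.Exports.
Local Open Scope classical_set_scope.
Local Open Scope ereal_scope.
Local Open Scope ring_scope.

(* Only the values on [0, 1] are meaningful.  At [t = 1] the division is by
   zero, hence the separate case. *)
Definition kies_cdf (R : realType) (lambda beta t : R) : R :=
  if t == 1 then 1 else 1 - expR (- (lambda * (t / (1 - t)) `^ beta)).

(* The [fine] here and in [kies_gamma] is harmless: the integrands take values
   in [0, 1]. *)
Definition kies_mixture_cdf d (T : measurableType d) (R : realType)
    (P : probability T R) (lambda beta : T -> R) (t : R) : R :=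
  fine 'E_P[fun w => kies_cdf (lambda w) (beta w) t].

Definition kies_gamma d (T : measurableType d) (R : realType)
    (P : probability T R) (lambda beta : T -> R) (x : R) : R :=
  x * (1 / fine 'E_P[fun w => expR (- (lambda w * x `^ beta w))] - 1).

(* The norm of [R * R] is the max-norm, see [prod_normE].  Suprema and infima
   are extended-real valued so that they need no boundedness or nonemptiness
   side conditions. *)
Definition hausdorff_distance (R : realType) (g h : set (R * R)) : \bar R :=
  maxe
    (ereal_sup [set ereal_inf [set `|A - B|%:E | B in h] | A in g])
    (ereal_sup [set ereal_inf [set `|A - B|%:E | A in g] | B in h]).

Definition vertically_convex (R : realType) (C : set (R * R)) : Prop :=
  forall t y1 y2 y : R, C (t, y1) -> C (t, y2) -> y1 <= y <= y2 -> C (t, y).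

(* Sendov's completed graph over [0, 1]: the least closed vertically convex set
   containing the graph.  It fills the jumps of [F] with vertical segments, and
   is the graph itself when [F] is continuous on [0, 1]. *)
Definition completed_graph (R : realType) (F : R -> R) : set (R * R) :=
  \bigcap_(C in [set C : set (R * R) | [/\ closed C, vertically_convex C &
      [set (t, F t) | t in `[0, 1]] `<=` C]]) C.

Definition saturation_corner (R : realType) : set (R * R) :=
  [set (0, y) | y in `[0, 1]] `|` [set (t, 1) | t in `[0, 1]].

Definition saturation (R : realType) (F : R -> R) : \bar R :=
  hausdorff_distance (completed_graph F) (@saturation_corner R).

(* Main.v *)
(* In the odds variable [x = t / (1 - t)] the mixture is [F t = 1 - L x] with
   [L x = E (exp (- lambda x^beta))] continuous and decreasing, and
   [gamma x = 1] says that [c = x / (x + 1)] satisfies [F c = 1 - c].  The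
   distance from a graph point [(t, F t)] to the corner curve is
   [min t (1 - F t)], which is largest where [t = 1 - F t], that is at [t = c].
   Conversely each corner point lies within [c] of the graph: the vertical
   segment below height [1 - c] is reached horizontally, by the intermediate
   value theorem on [[0, c]], the part of the corner around [(0, 1)] is within
   [c] of [(c, 1 - c)], and the rest of the horizontal segment is reached
   vertically. *)
Require Import Defs.
From HB Require Import structures.
From mathcomp Require Import all_boot all_order all_algebra.
From mathcomp Require Import all_classical all_reals all_analysis.
From mathcomp Require Import measurable_realfun ring lra.
Import Order.TTheory GRing.Theory Num.Theory.
Import numFieldNormedType.Exports.
Local Open Scope ereal_scope.
Local Open Scope ring_scope.

(** * Continuity of powers and strict positivity of integrals *)

(** Left of [0] the function is constant and right of [0] the power is differentiable; only [0]
    itself calls for an estimate. *)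
Lemma continuous_powR_max0 (R : realType) (b : R) :
  0 < b -> continuous (fun x : R => Num.max 0 x `^ b).
Proof.
move=> b0 x; have [x0|x0|x0] := ltgtP x 0.
- apply: (@cvg_trans _ ((0 `^ b : R) @[_ --> x])%classic).
    apply: near_eq_cvg; near=> y.
    by rewrite max_l// ltW//; near: y; exact: lt_nbhsl.
  by rewrite (max_l (ltW x0)); exact: (@cst_continuous R R).
- apply: (@cvg_trans _ (y `^ b @[y --> x])%classic).
    apply: near_eq_cvg; near=> y.
    by rewrite max_r// ltW//; near: y; exact: lt_nbhsr.
  rewrite (max_r (ltW x0)).
  have x0y : x \in `]0, +oo[ by rewrite in_itv/= x0.
  have /derivable1_diffP := @derivable_powR R 1 b x x0y.
  by move/differentiable_continuous.
- rewrite /continuous_at x0 maxxx powR0 ?gt_eqF//; apply/cvgrPdist_lt => e e0.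
  (* The radius e^(1/b) is the point where the power reaches [e]. *)
  have eb0 : 0 < e `^ b^-1 by rewrite powR_gt0.
  near=> y; rewrite sub0r normrN ger0_norm ?powR_ge0//.
  have ye : `|y| < e `^ b^-1.
    by near: y; exact: (@nbhs0_lt R R^o).
  rewrite -[ltRHS](@powRr1 _ e) ?ltW// -(@mulVf _ b) ?gt_eqF// powRrM.
  apply: gt0_ltr_powR => //; rewrite ?nnegrE ?le_max ?lexx ?powR_ge0//.
  by rewrite gt_max eb0 (le_lt_trans _ ye)// ler_norm.
Unshelve. all: by end_near. Qed.

(** A zero integral would make [f] vanish almost everywhere. As [f] vanishes nowhere, the
    exceptional null set is the whole space, whose probability is [1]. *)
Lemma Rintegral_gt0 d (T : measurableType d) (R : realType)
    (P : probability T R) (f : T -> R) :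
  P.-integrable [set: T] (EFin \o f) -> (forall w, 0 < f w) ->
  0 < \int[P]_w f w.
Proof.
move=> fi f0; rewrite lt_def Rintegral_ge0 ?andbT; last first.
  by move=> w _; exact/ltW.
apply/eqP => If0.
have: (\int[P]_w `|(EFin \o f) w|)%E = 0%E.
  rewrite -[RHS]/(0%:E) -If0 /Rintegral fineK ?integrable_fin_num//.
  by apply: eq_integral => w _ /=; rewrite ger0_norm// ltW.
move/ae_eq_integral_abs => -[//||N [mN PN0 subN]].
  exact: measurable_int fi.
have NT : N = [set: T]%classic.
  apply/seteqP; split => // w _; apply: subN => /= /(_ I) [].
  by apply/eqP; rewrite gt_eqF.
have := probability_setT P; rewrite -NT PN0 => /eqP.
by rewrite eqe eq_sym oner_eq0.
Qed.

(** The survival function of the mixture in the odds variable. *)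
Definition kies_survival {d} {T : measurableType d} {R : realType}
    (P : probability T R) (lambda beta : T -> R) (x : R) : R :=
  fine 'E_P[fun w => expR (- (lambda w * x `^ beta w))].

Lemma kies_survivalE d (T : measurableType d) (R : realType)
    (P : probability T R) (lambda beta : T -> R) (x : R) :
  kies_survival P lambda beta x =
  \int[P]_w expR (- (lambda w * x `^ beta w)).
Proof. by rewrite /kies_survival expectation.unlock. Qed.

(** * The mixture in the odds variable and the root of [gamma] *)

Section KiesSurvival.
Context {d} {T : measurableType d} {R : realType} (P : probability T R).
Variables lambda beta : {RV P >-> R}.
Hypothesis lambda_gt0 : forall w, 0 < lambda w.
Hypothesis beta_gt0 : forall w, 0 < beta w.

Local Notation L := (kies_survival P lambda beta).

Lemma measurable_kies_exp x :
  measurable_fun [set: T] (fun w => expR (- (lambda w * x `^ beta w))).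
Proof.
apply: (measurableT_comp (@measurable_expR R)).
apply: measurableT_comp => //; apply: measurable_funM => //.
exact: (measurableT_comp (measurable_powRr x)).
Qed.

Lemma kies_exp_le1 x w : expR (- (lambda w * x `^ beta w)) <= 1.
Proof. by rewrite -expR0 ler_expR oppr_le0 mulr_ge0 ?powR_ge0// ltW. Qed.

Lemma integrable_kies_exp x :
  P.-integrable [set: T] (EFin \o fun w => expR (- (lambda w * x `^ beta w))).
Proof.
apply: measurable_bounded_integrable => //.
- by rewrite ltey_eq fin_num_measure.
- exact: measurable_kies_exp.
- exists 1; split => // M M1 w _ /=.
  by rewrite ger0_norm ?expR_ge0// (le_trans (kies_exp_le1 x w))// ltW.
Qed.

Lemma integrable_one : P.-integrable [set: T] (EFin \o cst (1 : R)).
Proof. by apply: finite_measure_integrable_cst. Qed.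

Lemma expectation_kies_exp x :
  ('E_P[fun w => (expR (- (lambda w * x `^ beta w)))%R] = (L x)%:E)%E.
Proof.
rewrite /kies_survival fineK// expectation.unlock.
by apply: integrable_fin_num => //; exact: integrable_kies_exp.
Qed.

Lemma kies_gammaE x : kies_gamma P lambda beta x = x * ((L x)^-1 - 1).
Proof. by rewrite /kies_gamma div1r. Qed.

Lemma Rintegral_one : \int[P]_w (1 : R) = 1 :> R.
Proof.
by rewrite Rintegral_cst// mul1r; exact: (congr1 fine (probability_setT P)).
Qed.

Lemma kies_survival_gt0 x : 0 < L x.
Proof.
rewrite kies_survivalE; apply: Rintegral_gt0; first exact: integrable_kies_exp.
by move=> w; rewrite expR_gt0.
Qed.

Lemma kies_survival_le1 x : L x <= 1.
Proof.
rewrite kies_survivalE -Rintegral_one; apply: le_Rintegral => //.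
- exact: integrable_kies_exp.
- exact: integrable_one.
- by move=> w _; exact: kies_exp_le1.
Qed.

(** The integrand of [1 - L x] is positive everywhere. The strict bound makes the second factor of
    [gamma] positive. *)
Lemma kies_survival_lt1 x : 0 < x -> L x < 1.
Proof.
move=> x0; rewrite kies_survivalE -subr_gt0.
rewrite -{1}Rintegral_one -RintegralB//; last 2 first.
- exact: integrable_one.
- exact: integrable_kies_exp.
apply: Rintegral_gt0.
  exact: (integrableB _ integrable_one (integrable_kies_exp x)).
move=> w; rewrite subr_gt0 -expR0 ltr_expR oppr_lt0 mulr_gt0//.
exact: powR_gt0.
Qed.

Lemma kies_survival_nincr x y : 0 <= x -> x <= y -> L y <= L x.
Proof.
move=> x0 xy; rewrite !kies_survivalE.
apply: (le_Rintegral measurableT (integrable_kies_exp y)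
  (integrable_kies_exp x)).
move=> w _; rewrite ler_expR lerN2 ler_pM2l//.
by apply: (ge0_ler_powR (ltW (beta_gt0 w))); rewrite ?nnegrE ?(le_trans x0).
Qed.

Lemma kies_survival0 : L 0 = 1.
Proof.
rewrite kies_survivalE -[RHS]Rintegral_one; apply: eq_Rintegral => w _.
by rewrite powR0 ?gt_eqF// mulr0 oppr0 expR0.
Qed.

(* [powR] is discontinuous at [0] from the left, its value at negative bases
   being [1]; hence the truncation. *)
Lemma continuous_kies_survival : continuous (fun x : R => L (Num.max 0 x)).
Proof.
pose f (y : R) w : R := expR (- (lambda w * Num.max 0 y `^ beta w)).
have fi y : (`]y - 1, y + 1[%classic : set R) y by rewrite /= in_itv/=; lra.
have fint y : P.-integrable setT (EFin \o f y) by exact: integrable_kies_exp.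
have fub y : {ae P, forall w, setT w -> `|f y w| <= cst (1 : R) w}.
  by apply: aeW => w _; rewrite /f ger0_norm ?expR_ge0// kies_exp_le1.
have fc w : continuous (f ^~ w).
  have pc := continuous_powR_max0 _ _ (beta_gt0 w).
  have oc : continuous (fun z : R => expR (- (lambda w * z))).
    move=> z; apply: continuous_comp; last exact: continuous_expR.
    apply: continuous_comp; last exact: opp_continuous.
    exact: mulrl_continuous.
  by move=> y; exact: (continuous_comp (pc y) (oc _)).
move=> x; rewrite /continuous_at kies_survivalE.
under eq_cvg do rewrite kies_survivalE.
(* Dominated convergence on a neighbourhood of [x]: the constant [1] dominates the integrands and is
   integrable under a probability. *)
apply: (@continuity_under_integral _ _ _ P f setT measurableT
  (x - 1) (x + 1) (fun y _ => fint y) _ (cst 1) integrable_one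
  (fun y _ => fub y) x).
- by apply: aeW => w _ y _; exact: fc.
- by rewrite inE; exact: fi.
Qed.

(** The upper limit [1] is [L 0]. This later supplies graph points at prescribed heights. *)
Lemma kies_survival_IVT x y : 0 <= x -> L x <= y <= 1 ->
  exists2 z, 0 <= z <= x & L z = y.
Proof.
move=> x0 /andP[Lxy y1].
have [||z] := @IVT R (fun x => L (Num.max 0 x)) 0 x y x0.
- exact/continuous_subspaceT/continuous_kies_survival.
- by rewrite maxxx (max_r x0) kies_survival0 ge_min le_max Lxy y1 orbT.
- rewrite in_itv/= => /andP[z0 zx]; rewrite (max_r z0) => Lz.
  by exists z; rewrite ?z0.
Qed.

Lemma kies_survivalV_ndecr x y : 0 <= x -> x <= y -> (L x)^-1 <= (L y)^-1.
Proof.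
move=> x0 xy; have Lxy := kies_survival_nincr _ _ x0 xy.
rewrite lef_pV2; [exact: Lxy|rewrite posrE|rewrite posrE].
  exact: kies_survival_gt0.
exact: kies_survival_gt0.
Qed.

Lemma subr1_kies_survivalV_gt0 x : 0 < x -> 0 < (L x)^-1 - 1.
Proof.
move=> x0; have L1 := kies_survival_lt1 _ x0.
by rewrite subr_gt0 invf_gt1// kies_survival_gt0.
Qed.

(** The factor [(L x)^-1 - 1] is nondecreasing and positive at [y], while the factor [x] grows
    strictly. *)
Lemma kies_gamma_incr x y : 0 <= x -> x < y ->
  kies_gamma P lambda beta x < kies_gamma P lambda beta y.
Proof.
move=> x0 xy; rewrite !kies_gammaE.
have y0 : 0 < y by exact: le_lt_trans xy.
apply: (@le_lt_trans _ _ (x * ((L y)^-1 - 1))).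
  apply: (ler_wpM2l x0); apply: lerB; last exact: lexx.
  exact: kies_survivalV_ndecr (ltW xy).
by rewrite ltr_pM2r// subr1_kies_survivalV_gt0.
Qed.

Lemma continuous_kies_gamma :
  continuous (fun x : R => kies_gamma P lambda beta (Num.max 0 x)).
Proof.
under [X in continuous X]eq_fun do rewrite kies_gammaE.
move=> x; apply: cvgM.
  apply: (@continuous_max _ _ (cst 0) id); [exact: cvg_cst|exact: cvg_id].
apply: cvgB; last exact: cvg_cst.
apply: cvgV; first by rewrite gt_eqF// kies_survival_gt0.
exact: continuous_kies_survival.
Qed.

Lemma kies_gamma_root : exists! x, 0 <= x /\ kies_gamma P lambda beta x = 1.
Proof.
(* [gamma x >= x * gamma 1] for [x >= 1], and [gamma 1 > 0]. *)
set c := (L 1)^-1 - 1.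
have c0 : 0 < c by exact: subr1_kies_survivalV_gt0.
(* Chosen so that [M * c = c + 1], which exceeds [1]; [gamma] vanishes at the other end [0]. *)
pose M := 1 + c^-1.
have M1 : 1 <= M by rewrite lerDl invr_ge0 ltW.
have M0 : 0 <= M by exact: le_trans M1.
have gM : 1 <= kies_gamma P lambda beta M.
  rewrite kies_gammaE; apply: (@le_trans _ _ (M * c)).
    by rewrite mulrDl mulVf ?gt_eqF// mul1r lerDr ltW.
  by apply: (ler_wpM2l M0); apply: lerB; first exact: kies_survivalV_ndecr.
have [||x] := @IVT R (fun x => kies_gamma P lambda beta (Num.max 0 x)) 0 M 1 M0.
- exact/continuous_subspaceT/continuous_kies_gamma.
- have -> : kies_gamma P lambda beta (Num.max 0 0) = 0.
    by rewrite kies_gammaE maxxx mul0r.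
  by rewrite (max_r M0) ge_min ler01 le_max gM orbT.
rewrite in_itv/= => /andP[x0 _]; rewrite (max_r x0) => gx.
exists x; split => // y [y0 gy]; apply/eqP; rewrite eq_le !leNgt.
by apply/andP; split; apply/negP => /kies_gamma_incr; rewrite gx gy ltxx; auto.
Qed.

Lemma kies_mixture_cdfE t : t < 1 ->
  kies_mixture_cdf P lambda beta t = 1 - L (t / (1 - t)).
Proof.
move=> t1; rewrite /kies_mixture_cdf expectation.unlock.
rewrite kies_survivalE -{1}Rintegral_one.
rewrite -RintegralB//; [|exact: integrable_one|exact: integrable_kies_exp].
by apply: eq_Rintegral => w _; rewrite /kies_cdf lt_eqF.
Qed.

Lemma kies_mixture_cdf1 : kies_mixture_cdf P lambda beta 1 = 1.
Proof.
rewrite /kies_mixture_cdf expectation.unlock -[RHS]Rintegral_one.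
by apply: eq_Rintegral => w _; rewrite /kies_cdf eqxx.
Qed.

End KiesSurvival.

(** * Hausdorff distance from a completed graph to the corner curve *)

Section SaturationCorner.
Context {R : realType}.
Implicit Types (F : R -> R) (c : R).

Lemma graph_completed_graph F t : 0 <= t <= 1 -> completed_graph F (t, F t).
Proof.
by move=> t01 C [_ _ FC]; apply: FC; exists t.
Qed.

(* The bound on the right defines a closed vertically convex set, so continuity
   of [F] is not required to control its completed graph. *)
Lemma completed_graph_sub F c :
  (forall t, 0 <= t <= 1 -> 0 <= F t <= 1) ->
  (forall t, c < t -> t <= 1 -> 1 - c <= F t) ->
  forall t y, completed_graph F (t, y) ->
  [/\ 0 <= t <= 1, 0 <= y <= 1 & t <= c \/ 1 - c <= y].
Proof.
move=> F1 Fc t y.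
(* The unit square without the lower right rectangle where [t > c] and [y < 1 - c]. *)
pose C : set (R * R) := [set A | [/\ 0 <= A.1 <= 1, 0 <= A.2 <= 1 &
  A.1 <= c \/ 1 - c <= A.2]]%classic.
move=> /(_ C); apply; split.
- rewrite (_ : C = (fst @^-1` [set x : R | 0 <= x] `&`
    fst @^-1` [set x : R | x <= 1] `&`
    (snd @^-1` [set x : R | 0 <= x] `&` snd @^-1` [set x : R | x <= 1]) `&`
    (fst @^-1` [set x : R | x <= c] `|`
     snd @^-1` [set x : R | 1 - c <= x]))%classic); last first.
    apply/seteqP; split => -[a b] /=.
      by move=> [/andP[? ?] /andP[? ?] ?].
    by move=> [[[? ?] [? ?]] ?]; split => //; apply/andP.
  have pf (D : set R) : closed D -> closed ((fst : R * R -> R) @^-1` D)%classic.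
    by apply: preimage_closed => x _; exact: cvg_fst.
  have ps (D : set R) : closed D -> closed ((snd : R * R -> R) @^-1` D)%classic.
    by apply: preimage_closed => x _; exact: cvg_snd.
  apply: closedI; last first.
    apply: closedU; [apply: pf; exact: closed_le|].
    by apply: ps; exact: closed_ge.
  apply: closedI; apply: closedI;
    by [apply: pf; exact: closed_ge|apply: pf; exact: closed_le|
        apply: ps; exact: closed_ge|apply: ps; exact: closed_le].
(* The lower endpoint passes on the alternative and the bound by [0], the upper endpoint the bound
   by [1]. *)
- move=> a y1 y2 z [/= a01 /andP[y10 _] ay1] [/= _ /andP[_ y21] _].
  move=> /andP[y1z zy2]; split => //=.
    by rewrite (le_trans y10)// (le_trans zy2).
  by case: ay1 => [|cy1]; [left|right; exact: le_trans y1z].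
- move=> _ [s /= + <-]; rewrite in_itv/= => s01; split => //=; first exact: F1.
  have [sc|cs] := leP s c; [by left|right].
  by apply: Fc => //; case/andP: s01.
Qed.

Lemma hausdorff_distance_le (g h : set (R * R)) (c : R) :
  (forall A, g A -> exists2 B, h B & `|A - B| <= c) ->
  (forall B, h B -> exists2 A, g A & `|A - B| <= c) ->
  (hausdorff_distance g h <= c%:E)%E.
Proof.
move=> gh hg; rewrite /hausdorff_distance ge_max; apply/andP; split.
- apply: ge_ereal_sup => _ [A gA <-]; have [B hB AB] := gh A gA.
  by apply: (@le_trans _ _ `|A - B|%:E); [apply: ereal_inf_lbound; exists B|].
- apply: ge_ereal_sup => _ [B hB <-]; have [A gA AB] := hg B hB.
  by apply: (@le_trans _ _ `|A - B|%:E); [apply: ereal_inf_lbound; exists A|].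
Qed.

Lemma hausdorff_distance_ge (g h : set (R * R)) (c : R) (A : R * R) :
  g A -> (forall B, h B -> c <= `|A - B|) ->
  (c%:E <= hausdorff_distance g h)%E.
Proof.
move=> gA Ah; rewrite /hausdorff_distance le_max; apply/orP; left.
apply: (@le_trans _ _ (ereal_inf [set `|A - B|%:E | B in h]%classic)).
  by apply: le_ereal_inf_tmp => _ [B hB <-]; rewrite lee_fin Ah.
by apply: ereal_sup_ubound; exists A.
Qed.

(** Isolates the geometry: the graph crosses the antidiagonal at [c], stays above height [1 - c]
    afterwards, and takes every height up to [1 - c] before. *)
Lemma saturation_fixed_point F c : 0 <= c <= 1 ->
  (forall t, 0 <= t <= 1 -> 0 <= F t <= 1) ->
  (forall t, c <= t -> t <= 1 -> 1 - c <= F t) ->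
  F c = 1 - c ->
  (forall y, 0 <= y <= 1 - c -> exists2 t, 0 <= t <= c & F t = y) ->
  saturation F = c%:E.
Proof.
move=> /andP[c0 c1] F1 Fge Fc Fsurj.
have Gc : completed_graph F (c, 1 - c).
  by rewrite -Fc; apply: graph_completed_graph; rewrite c0.
apply/eqP; rewrite eq_le; apply/andP; split; last first.
  (* The point [(c, 1 - c)] is [c] away horizontally from the vertical segment and [c] away
     vertically from the horizontal one. *)
  apply: hausdorff_distance_ge Gc _ => -[t y] /=.
  rewrite prod_normE /= le_max.
  move=> [[z _ [<- _]]|[z _ [_ <-]]].
    by rewrite subr0 (ger0_norm c0) lexx.
  by rewrite addrAC subrr add0r normrN (ger0_norm c0) lexx orbT.
apply: hausdorff_distance_le => -[t y].
  move=> G; have [/andP[t0 t1] /andP[y0 y1] tyc] :=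
    completed_graph_sub F c F1 (fun t ct => Fge t (ltW ct)) t y G.
  (* Points up to abscissa [c] project horizontally onto the corner curve, the others vertically. *)
  have [tc|cy] := leP t c.
    exists (0, y); first by left; exists y; rewrite //= in_itv/= y0.
    by rewrite prod_normE /= subr0 subrr normr0 ge_max c0 andbT ger0_norm.
  have {}cy : 1 - c <= y by case: tyc => // tc; move: cy; rewrite ltNge tc.
  exists (t, 1); first by right; exists t; rewrite //= in_itv/= t0.
  by rewrite prod_normE /= subrr normr0 ge_max c0 /= ler_norml; lra.
move=> [[z /= + [<- <-]]|[z /= + [<- <-]]]; rewrite in_itv/= => /andP[z0 z1].
- have [zc|cz] := leP z (1 - c).
    have [|s /andP[s0 sc] Fs] := Fsurj z; first by rewrite z0.
    exists (s, z).
      by rewrite -Fs; apply: graph_completed_graph; rewrite s0 (le_trans sc).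
    by rewrite prod_normE /= subr0 subrr normr0 ge_max c0 ger0_norm// sc.
  exists (c, 1 - c) => //.
  by rewrite prod_normE /= ge_max subr0 ger0_norm// lexx /= ler_norml; lra.
- have [zc|cz] := leP z c.
    exists (c, 1 - c) => //; rewrite prod_normE /= ge_max !ler_norml; lra.
  exists (z, F z); first by apply: graph_completed_graph; rewrite z0.
  have Fz := Fge z (ltW cz) z1.
  have /andP[_ Fz1] : 0 <= F z <= 1 by apply: F1; rewrite z0.
  by rewrite prod_normE /= ge_max subrr normr0 c0 /= ler_norml; lra.
Qed.

End SaturationCorner.

(** * Return from odds to the variable [t] *)

Lemma odds_probK {F : realFieldType} (x : F) :
  0 <= x -> x / (x + 1) / (1 - x / (x + 1)) = x.
Proof.
move=> x0; have x1 : x + 1 != 0 by rewrite gt_eqF// ltr_wpDl.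
by field; rewrite x1 addrAC subrr add0r oner_eq0.
Qed.

Theorem theorem4p6 (d : measure_display) (T : measurableType d) (R : realType)
    (P : probability T R) (lambda beta : {RV P >-> R})
    (lambda_gt0 : forall w : T, 0 < lambda w)
    (beta_gt0 : forall w : T, 0 < beta w)
    (hE1 : ('E_P[fun w => ((beta w / (lambda w `^ (1 / beta w))) *
              (((beta w + 1) / beta w) `^ ((beta w + 1) / beta w)))%R] < +oo)%E)
    (hE2 : ('E_P[lambda] < +oo)%E)
    (hE3 : ('E_P[fun w => (lambda w * beta w)%R] < +oo)%E) :
  (exists! x : R, 0 <= x /\ kies_gamma P lambda beta x = 1) /\
  (forall xbar : R, 0 <= xbar -> kies_gamma P lambda beta xbar = 1 ->
    let tau := fun w : T => lambda w * xbar `^ beta w in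
    saturation (kies_mixture_cdf P lambda beta) = 'E_P[fun w => expR (- tau w)] /\
    'E_P[fun w => expR (- tau w)] = (xbar / (xbar + 1))%:E).
Proof.
split; first exact: kies_gamma_root.
move=> x x0 gx tau.
have -> : 'E_P[fun w => expR (- tau w)] = (kies_survival P lambda beta x)%:E.
  exact: expectation_kies_exp.
set c := x / (x + 1).
have x10 : x + 1 != 0 by rewrite gt_eqF// ltr_wpDl.
have Lx : kies_survival P lambda beta x = c.
  have L0 := kies_survival_gt0 P lambda beta lambda_gt0 x.
  move: gx; rewrite kies_gammaE /c; move: (kies_survival _ _ _ x) L0 => l l0 xl.
  have l1 : l != 0 by rewrite gt_eqF.
  (* Multiplying by [l] turns the root equation into [x * (1 - l) = l], which is linear in [l]. *)
  have xll := congr1 ( *%R^~ l) xl.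
  rewrite /= mul1r -mulrA mulrBl mulVf// mul1r in xll.
  by apply: (mulIf x10); rewrite divfK//; lra.
rewrite Lx; split => //.
have c0 : 0 <= c by rewrite divr_ge0// addr_ge0.
have c1 : c < 1 by rewrite ltr_pdivrMr ?mul1r ?ltrDl// ltr_wpDl.
have cx : c / (1 - c) = x by exact: odds_probK.
have FE t : t < 1 -> _ := kies_mixture_cdfE P lambda beta lambda_gt0 t.
apply: saturation_fixed_point.
- by rewrite c0 ltW.
- move=> t /andP[t0]; rewrite le_eqVlt => /predU1P[->|t1].
    by rewrite kies_mixture_cdf1 ler01 lexx.
  rewrite FE// subr_ge0 kies_survival_le1//= gerBl.
  exact: ltW (kies_survival_gt0 _ _ _ lambda_gt0 _).
- move=> t ct; rewrite le_eqVlt => /predU1P[->|t1].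
    by rewrite kies_mixture_cdf1 gerBl.
  rewrite FE// lerB// -Lx; apply: kies_survival_nincr => //.
  (* The odds map is increasing: [c <= t] gives [c / (1 - c) <= t / (1 - t)] after clearing
     denominators. *)
  rewrite -cx ler_pdivlMr ?subr_gt0// mulrAC ler_pdivrMr ?subr_gt0//.
  nra.
- by rewrite FE// cx Lx.
- move=> y /andP[y0 yc].
  (* Height [y] means survival [1 - y], which lies between [L x = c] and [1]; the odds [z] found are
     at most [x], so the time [z / (z + 1)] is at most [c]. *)
  have [|z /andP[z0 zx] Lz] :=
    kies_survival_IVT P lambda beta lambda_gt0 beta_gt0 x (1 - y) x0.
    by rewrite Lx; lra.
  have z1 : 0 < z + 1 by rewrite ltr_wpDl.
  exists (z / (z + 1)).
    rewrite divr_ge0 ?(ltW z1)//= /c.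
    rewrite ler_pdivrMr// mulrAC ler_pdivlMr ?ltr_wpDl//.
    nra.
  rewrite FE ?ltr_pdivrMr ?mul1r ?ltrDl//.
  rewrite odds_probK//.
  by rewrite Lz subKr.
Qed.
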